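(* Let $M>1$ be real and $n\in\mathbb{N}=\{1,2,\dots\}$. For $v\in\left[0,\frac{(M-1)n}{(n-1)M}\right]$ (upper endpoint $+\infty$ if $n=1$) let $(\alpha^*(v),\beta^*(v))$ be the stepsize schedule defined in the context. For $R,\sigma>0$, let $h_{\mathrm{silver}}(v,R,\sigma)$ and $h_{\mathrm{constant}}(R,\sigma)$ denote the optimal values of the two-step performance estimation problem defined in the context under the stepsizes $(\alpha,\beta)=(\alpha^*(v),\beta^*(v))$ and $\alpha=\beta=\frac{2}{M+1}$, respectively. Then there exists $\mathscr{U}(M,n)>0$, depending only on $M$ and $n$, such that whenever $R,\sigma>0$ satisfy $\frac{\sigma}{R}<\sqrt{\mathscr{U}(M,n)}$, there exists $\bar v\in\left[0,\frac{(M-1)n}{(n-1)M}\right]$ with $$\frac{h_{\mathrm{silver}}(\bar v,R,\sigma)}{h_{\mathrm{constant}}(R,\sigma)}\le\mathscr{C}<1,$$ where $$\mathscr{C}:=\frac12+\frac12\,\frac{(M+1)^4\bigl(\sqrt{2M^2-2M+1}-M\bigr)^2}{(M-1)^4\bigl(2+\sqrt{2M^2-2M+1}-M\bigr)^2}.$$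
   Context: **Conventions.** For $n=1$, $\frac{(M-1)n}{(n-1)M}=+\infty$ and $v$ is any nonnegative real. **The schedule $(\alpha^*,\beta^* )$.** Given $(M,n,v)$, $\alpha^*=\alpha^*(v)$ is the unique element of $[\frac1M,1)$ solving $$0=(M-1)Mn\,\alpha^3-(M+1)(M-2)n\,\alpha^2-(4n+(M-1)(n-1)v)\alpha+2n,$$ and $\beta^*=\beta^*(v)$ is the unique element of $(\frac{\alpha^*}{M},\frac{M+1}{2M})$ such that $(\alpha,\beta)=(\alpha^*,\beta^* )$ satisfies $$\begin{aligned} 0=\ & Mn\left((M-1)^2n+(M+1)^2(n-1)v\right)\left((M-1)\alpha+(M+1)\right)\beta^2\\ &+2M\Bigl[2(M-1)Mn(-n+(n-1)v)\alpha^2+(1+M)(-n+(n-1)v)\bigl((3-M)n+(M-1)(n-1)v\bigr)\alpha\\ &\qquad+n\bigl(n-(M-4)Mn-(1+M)(3+M)(n-1)v\bigr)\Bigr]\beta\\ &+\Bigl[-2M(M^2-1)n(-n+(n-1)v)\alpha^2\\ &\qquad+\bigl(2(2+M+2M^2-M^3)n^2+(M-3)(1+M)^2(n-1)nv+(1-M)(1+M)^2(n-1)^2v^2\bigr)\alpha\\ &\qquad+2(1+M)^2n(-n+(n-1)v)\Bigr]. \end{aligned}$$ (Existence and uniqueness of $\alpha^*,\beta^*$ are known.) **Two-step performance estimation problem (PEP).** Throughout the strong convexity parameter is $m=1$. Let $\mathcal{F}_{1,M}$ be the class of proper, closed, $1$-strongly convex functions $f:\mathbb{R}^d\to\mathbb{R}$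 with $M$-Lipschitz gradient ($d\ge1$ arbitrary). For stepsizes $\alpha,\beta>0$, the problem is to take the supremum of $\mathbb{E}_{\xi_0,\xi_1}[\|x_2-x_*\|^2]$ over all $f\in\mathcal{F}_{1,M}$ with $\nabla f(x_* )=\mathbf 0$, all $x_0$ with $\|x_0-x_*\|^2\le R^2$, and all stochastic gradients $g$, where $x_1=x_0-\alpha g(x_0,\xi_0)$ and $x_2=x_1-\beta g(x_1,\xi_1)$, and at every queried point $x$ the stochastic gradient takes $n$ equally likely values $g(x,\xi^{(1)}),\dots,g(x,\xi^{(n)})$ with $\frac1n\sum_i g(x,\xi^{(i)})=\nabla f(x)$ and $\frac1n\sum_i\|g(x,\xi^{(i)})-\nabla f(x)\|^2\le\sigma^2$. Explicitly: $x_{1^{(i)}}=x_0-\alpha g(x_0,\xi_0^{(i)})$ for $i=1,\dots,n$, the mean and variance conditions hold at $x_0$ and at each $x_{1^{(i)}}$, and the objective is $\frac1{n^2}\sum_{i,j=1}^n\|x_{1^{(i)}}-\beta g(x_{1^{(i)}},\xi_{1^{(i)}}^{(j)})-x_*\|^2$. The optimal value is this supremum. *)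

(* Defs.v *)
From HB Require Import structures.
From mathcomp Require Import all_boot all_order all_algebra.
From mathcomp Require Import all_classical all_reals all_analysis.

Set Implicit Arguments.
Unset Strict Implicit.
Unset Printing Implicit Defensive.

Import Order.TTheory GRing.Theory Num.Theory.
Import numFieldNormedType.Exports.

Local Open Scope classical_set_scope.
Local Open Scope ring_scope.

(* The library norm on 'rV[R]_d.+1 is the sup norm, so the Euclidean norm is
   introduced separately; both induce the same topology and the same notion of
   differentiability. *)
Definition sqnorm (R : realType) (d : nat) (x : 'rV[R]_d.+1) : R :=
  \sum_(i < d.+1) x 0 i ^+ 2.

Definition enorm (R : realType) (d : nat) (x : 'rV[R]_d.+1) : R :=
  Num.sqrt (sqnorm x).

Definition gradient (R : realType) (d : nat) (f : 'rV[R]_d.+1 -> R)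
    (x : 'rV[R]_d.+1) : 'rV[R]_d.+1 :=
  \row_(i < d.+1) 'D_(delta_mx 0 i) (f : 'rV[R]_d.+1 -> R^o) x.

Definition strongly_convex (R : realType) (d : nat) (m : R)
    (f : 'rV[R]_d.+1 -> R) : Prop :=
  convex_function [set: 'rV[R]_d.+1] (fun x => f x - m / 2 * sqnorm x).

Definition closed_function (R : realType) (d : nat)
    (f : 'rV[R]_d.+1 -> R) : Prop :=
  closed [set p : ('rV[R]_d.+1 * R)%type | f p.1 <= p.2].

Definition lipschitz_gradient (R : realType) (d : nat) (M : R)
    (f : 'rV[R]_d.+1 -> R) : Prop :=
  (forall x, differentiable (f : 'rV[R]_d.+1 -> R^o) x) /\
  (forall x y, enorm (gradient f x - gradient f y) <= M * enorm (x - y)).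

(* Properness is automatic for real-valued functions. *)
Definition smooth_strongly_convex (R : realType) (d : nat) (m M : R)
    (f : 'rV[R]_d.+1 -> R) : Prop :=
  [/\ closed_function f, strongly_convex m f & lipschitz_gradient M f].

(* G lists the n equally likely values of a stochastic gradient whose mean is
   the true gradient gr. *)
Definition stochastic_gradient_at (R : realType) (d n : nat) (sigma : R)
    (gr : 'rV[R]_d.+1) (G : 'I_n -> 'rV[R]_d.+1) : Prop :=
  n%:R^-1 *: (\sum_(i < n) G i) = gr /\
  n%:R^-1 * (\sum_(i < n) sqnorm (G i - gr)) <= sigma ^+ 2.

(* x_{1^(i)} = x_0 - alpha g(x_0, xi_0^(i)) *)
Definition first_iterate (R : realType) (d n : nat) (alpha : R) (Xi : Type)
    (x0 : 'rV[R]_d.+1) (g : 'rV[R]_d.+1 -> Xi -> 'rV[R]_d.+1)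
    (xi0 : 'I_n -> Xi) (i : 'I_n) : 'rV[R]_d.+1 :=
  x0 - alpha *: g x0 (xi0 i).

(* xi0 i is xi_0^(i), and xi1 i j is xi_{1^(i)}^(j), the j-th sample drawn at
   the point x_{1^(i)}. *)
Definition pep_feasible (R : realType) (d n : nat) (M r sigma alpha : R)
    (Xi : Type) (f : 'rV[R]_d.+1 -> R) (xs x0 : 'rV[R]_d.+1)
    (g : 'rV[R]_d.+1 -> Xi -> 'rV[R]_d.+1)
    (xi0 : 'I_n -> Xi) (xi1 : 'I_n -> 'I_n -> Xi) : Prop :=
  [/\ smooth_strongly_convex 1 M f,
      gradient f xs = 0,
      sqnorm (x0 - xs) <= r ^+ 2,
      stochastic_gradient_at sigma (gradient f x0) (fun i => g x0 (xi0 i))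
    & forall i, let x1 := first_iterate alpha x0 g xi0 i in
        stochastic_gradient_at sigma (gradient f x1)
          (fun j => g x1 (xi1 i j))].

Definition pep_objective (R : realType) (d n : nat) (alpha beta : R)
    (Xi : Type) (xs x0 : 'rV[R]_d.+1)
    (g : 'rV[R]_d.+1 -> Xi -> 'rV[R]_d.+1)
    (xi0 : 'I_n -> Xi) (xi1 : 'I_n -> 'I_n -> Xi) : R :=
  (n%:R ^+ 2)^-1 * \sum_(i < n) \sum_(j < n)
    (let x1 := first_iterate alpha x0 g xi0 i in
     sqnorm (x1 - beta *: g x1 (xi1 i j) - xs)).

(* The supremum ranges over all dimensions d.+1 and all sample spaces Xi. *)
Definition pep_value (R : realType) (M : R) (n : nat) (alpha beta r sigma : R)
    : \bar R :=
  ereal_sup [set y : \bar R |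
    exists (d : nat) (Xi : Type) (f : 'rV[R]_d.+1 -> R)
           (xs x0 : 'rV[R]_d.+1) (g : 'rV[R]_d.+1 -> Xi -> 'rV[R]_d.+1)
           (xi0 : 'I_n -> Xi) (xi1 : 'I_n -> 'I_n -> Xi),
      pep_feasible M r sigma alpha f xs x0 g xi0 xi1 /\
      y = (pep_objective alpha beta xs x0 g xi0 xi1)%:E].

Definition v_max (R : realType) (M : R) (n : nat) : \bar R :=
  if n == 1%N then +oo%E else ((M - 1) * n%:R / ((n%:R - 1) * M))%:E.

Definition is_alpha_star (R : realType) (M : R) (k : nat) (v alpha : R)
    : Prop :=
  let n : R := k%:R in
  M^-1 <= alpha < 1 /\
  0 = (M - 1) * M * n * alpha ^+ 3 - (M + 1) * (M - 2) * n * alpha ^+ 2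
      - (4 * n + (M - 1) * (n - 1) * v) * alpha + 2 * n.

Definition is_beta_star (R : realType) (M : R) (k : nat) (v alpha beta : R)
    : Prop :=
  let n : R := k%:R in
  alpha / M < beta < (M + 1) / (2 * M) /\
  0 = M * n * ((M - 1) ^+ 2 * n + (M + 1) ^+ 2 * (n - 1) * v)
        * ((M - 1) * alpha + (M + 1)) * beta ^+ 2
      + 2 * M *
        (2 * (M - 1) * M * n * (- n + (n - 1) * v) * alpha ^+ 2
         + (1 + M) * (- n + (n - 1) * v)
           * ((3 - M) * n + (M - 1) * (n - 1) * v) * alpha
         + n * (n - (M - 4) * M * n - (1 + M) * (3 + M) * (n - 1) * v))
        * beta
      + (- 2 * M * (M ^+ 2 - 1) * n * (- n + (n - 1) * v) * alpha ^+ 2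
         + (2 * (2 + M + 2 * M ^+ 2 - M ^+ 3) * n ^+ 2
            + (M - 3) * (1 + M) ^+ 2 * (n - 1) * n * v
            + (1 - M) * (1 + M) ^+ 2 * (n - 1) ^+ 2 * v ^+ 2) * alpha
         + 2 * (1 + M) ^+ 2 * n * (- n + (n - 1) * v)).

(* The root exists and is unique for 1 < M, 0 < n and 0 <= v <= v_max M n, so
   the default value 0 of xget plays no role there; likewise for beta_star. *)
Definition alpha_star (R : realType) (M : R) (n : nat) (v : R) : R :=
  xget 0 [set alpha | is_alpha_star M n v alpha].

Definition beta_star (R : realType) (M : R) (n : nat) (v : R) : R :=
  xget 0 [set beta | is_beta_star M n v (alpha_star M n v) beta].

Definition h_silver (R : realType) (M : R) (n : nat) (v r sigma : R)
    : \bar R :=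
  pep_value M n (alpha_star M n v) (beta_star M n v) r sigma.

Definition h_constant (R : realType) (M : R) (n : nat) (r sigma : R)
    : \bar R :=
  pep_value M n (2 / (M + 1)) (2 / (M + 1)) r sigma.

Definition ratio_bound (R : realType) (M : R) : R :=
  let s := Num.sqrt (2 * M ^+ 2 - 2 * M + 1) in
  1 / 2 + 1 / 2 * (((M + 1) ^+ 4 * (s - M) ^+ 2)
                   / ((M - 1) ^+ 4 * (2 + s - M) ^+ 2)).

(* Main.v *)
Require Import Defs.
From HB Require Import structures.
From mathcomp Require Import all_boot all_order all_algebra.
From mathcomp Require Import all_classical all_reals all_analysis.
From mathcomp Require Import ring lra.

Set Implicit Arguments.
Unset Strict Implicit.
Unset Printing Implicit Defensive.

Import Order.TTheory GRing.Theory Num.Theory.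
Import numFieldNormedType.Exports.

Local Open Scope classical_set_scope.
Local Open Scope ring_scope.

(** At [v = 0] the schedule is the optimal two-step schedule for noiseless
    gradient descent, whose worst-case contraction factor [rs] is strictly smaller
    than the factor [rc = ((M - 1) / (M + 1)) ^ 4] of two constant steps; the bound
    to be proved is [(1 + rs / rc) / 2]. Noise adds at most [eps * rs * r ^ 2] plus
    a multiple of [sigma ^ 2] to the silver value, while the noiseless quadratic
    [|x|^2 / 2] shows that the constant schedule is worth at least [rc * r ^ 2], so
    [v = 0] works as soon as [sigma / r] is small.

    All radicals disappear with [k = (sqrt (2 M^2 - 2 M + 1) - 1) / M]: then
    [M = 2 (1 + k) / (2 - k^2)], [alpha = (2 - k^2) / (2 + k)],
    [beta = (2 - k^2) / ((2 - k) (1 + k))] and [sqrt rs = k^2 / (4 - k^2)]. The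
    deterministic rate is an exact nonnegative combination of five interpolation
    inequalities between [x0], [x1] and the minimizer. *)

(** * The Euclidean inner product *)

Definition dot (R : realType) (d : nat) (x y : 'rV[R]_d.+1) : R :=
  \sum_(i < d.+1) x 0 i * y 0 i.

Lemma dotC (R : realType) (d : nat) (x y : 'rV[R]_d.+1) : dot x y = dot y x.
Proof. by apply: eq_bigr => i _; rewrite mulrC. Qed.

Lemma dotDl (R : realType) (d : nat) (x y z : 'rV[R]_d.+1) :
  dot (x + y) z = dot x z + dot y z.
Proof. by rewrite -big_split; apply: eq_bigr => i _; rewrite !mxE mulrDl. Qed.

Lemma dotZl (R : realType) (d : nat) (a : R) (x z : 'rV[R]_d.+1) :
  dot (a *: x) z = a * dot x z.
Proof. by rewrite mulr_sumr; apply: eq_bigr => i _; rewrite !mxE mulrA. Qed.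

Lemma dotNl (R : realType) (d : nat) (x z : 'rV[R]_d.+1) :
  dot (- x) z = - dot x z.
Proof. by rewrite -scaleN1r dotZl mulN1r. Qed.

Lemma dotDr (R : realType) (d : nat) (x y z : 'rV[R]_d.+1) :
  dot z (x + y) = dot z x + dot z y.
Proof. by rewrite dotC dotDl !(dotC z). Qed.

Lemma dotZr (R : realType) (d : nat) (a : R) (x z : 'rV[R]_d.+1) :
  dot z (a *: x) = a * dot z x.
Proof. by rewrite dotC dotZl (dotC z). Qed.

Lemma dotNr (R : realType) (d : nat) (x z : 'rV[R]_d.+1) :
  dot z (- x) = - dot z x.
Proof. by rewrite dotC dotNl (dotC z). Qed.

(** Rewriting with these rules expands squared norms into inner products of the basic vectors,
    leaving real arithmetic. *)
Definition dotE := (dotDl, dotDr, dotNl, dotNr, dotZl, dotZr).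

Lemma sqnormE (R : realType) (d : nat) (x : 'rV[R]_d.+1) : sqnorm x = dot x x.
Proof. by apply: eq_bigr => i _; rewrite expr2. Qed.

Lemma sqnorm_ge0 (R : realType) (d : nat) (x : 'rV[R]_d.+1) : 0 <= sqnorm x.
Proof. by apply: sumr_ge0 => i _; rewrite sqr_ge0. Qed.

Lemma sqnorm0 (R : realType) (d : nat) : sqnorm (0 : 'rV[R]_d.+1) = 0.
Proof. by rewrite sqnormE -(scale0r (0 : 'rV[R]_d.+1)) dotZl mul0r. Qed.

Lemma sqnorm_le0_dot0 (R : realType) (d : nat) (x y : 'rV[R]_d.+1) :
  sqnorm x <= 0 -> dot x y = 0.
Proof.
move=> x0; rewrite /dot big1// => i _.
have : x 0 i ^+ 2 <= 0.
  apply: le_trans x0; rewrite /sqnorm (bigD1 i)//= lerDl.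
  by apply: sumr_ge0 => j _; rewrite sqr_ge0.
by rewrite le_eqVlt ltNge sqr_ge0 orbF sqrf_eq0 => /eqP ->; rewrite mul0r.
Qed.

(** A Cauchy-Schwarz bound without square roots: for [L > 0], expand [0 <= sqnorm (u - L *: w)] and
    cancel [L]; for [L = 0] the vector [u] vanishes. *)
Lemma dot_lipschitz_le (R : realType) (d : nat) (L : R) (u w : 'rV[R]_d.+1) :
  0 <= L -> sqnorm u <= L ^+ 2 * sqnorm w -> dot u w <= L * sqnorm w.
Proof.
move=> L0 uw; have [L00|Lp] := leP L 0.
  have -> : dot u w = 0.
    apply: sqnorm_le0_dot0; apply: le_trans uw _.
    by have -> : L = 0 by [apply/le_anti/andP]; rewrite expr0n mul0r.
  by rewrite mulr_ge0// sqnorm_ge0.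
have := sqnorm_ge0 (u - L *: w); rewrite !sqnormE !dotE (dotC w u).
move: uw; rewrite !sqnormE; set a := dot u u; set b := dot u w; set c := dot w w.
move=> ac H; rewrite -(ler_pM2l Lp); nra.
Qed.

(** * Smoothness, strong convexity and interpolation *)

Lemma lipschitz_gradient_sqnorm (R : realType) (d : nat) (M : R)
    (f : 'rV[R]_d.+1 -> R) (x y : 'rV[R]_d.+1) : 0 <= M ->
  lipschitz_gradient M f ->
  sqnorm (gradient f x - gradient f y) <= M ^+ 2 * sqnorm (x - y).
Proof.
move=> M0 [_ /(_ x y)]; rewrite /enorm => H.
rewrite -[leLHS]sqr_sqrtr ?sqnorm_ge0// -[sqnorm (x - y)]sqr_sqrtr ?sqnorm_ge0//.
by rewrite -exprMn lerXn2r// nnegrE ?mulr_ge0// sqrtr_ge0.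
Qed.

Lemma derive_gradient (R : realType) (d : nat) (f : 'rV[R]_d.+1 -> R)
    (x v : 'rV[R]_d.+1) : differentiable (f : 'rV[R]_d.+1 -> R^o) x ->
  'D_v (f : 'rV[R]_d.+1 -> R^o) x = dot (gradient f x) v.
Proof.
move=> df; rewrite deriveE// {1}[v]row_sum_delta linear_sum.
by apply: eq_bigr => i _; rewrite linearZ /= mxE deriveE// mulrC.
Qed.

(** The difference quotient along the line is literally the one defining the derivative of [f] at
    [x + t *: v] in direction [v]. *)
Lemma is_derive_line (R : realType) (d : nat) (f : 'rV[R]_d.+1 -> R)
    (x v : 'rV[R]_d.+1) (t : R) :
  differentiable (f : 'rV[R]_d.+1 -> R^o) (x + t *: v) ->
  is_derive t 1 (fun s : R => f (x + s *: v) : R^o)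
    (dot (gradient f (x + t *: v)) v).
Proof.
move=> df.
have E : (fun h : R => h^-1 *: (((fun s : R => f (x + s *: v) : R^o) \o shift t)
            (h *: (1 : R^o)) - (f (x + t *: v) : R^o))) =
   (fun h : R => h^-1 *: (((f : _ -> R^o) \o shift (x + t *: v)) (h *: v)
       - (f (x + t *: v) : R^o))).
  apply/funext => h /=; congr (_ *: (f _ - _)).
  by rewrite /shift /= [h *: _]mulr1 scalerDl addrCA.
split; first by rewrite /derivable E; exact: diff_derivable.
by rewrite -derive_gradient// /derive E.
Qed.

Lemma descent (R : realType) (d : nat) (M : R) (f : 'rV[R]_d.+1 -> R)
    (x v : 'rV[R]_d.+1) : 0 <= M -> lipschitz_gradient M f ->
  f (x + v) <= f x + dot (gradient f x) v + M / 2 * sqnorm v.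
Proof.
move=> M0 Lf; have [df _] := Lf.
(* [psi] is [f] along the segment minus its quadratic upper model without the constant term. The
   claim is [psi 1 <= psi 0], which the mean value theorem reduces to the sign of [dpsi]. *)
pose psi := fun t : R => (f (x + t *: v) : R^o)
   - (t * dot (gradient f x) v + t ^+ 2 * (M / 2 * sqnorm v)).
pose dpsi := fun t : R => dot (gradient f (x + t *: v)) v
   - (dot (gradient f x) v + 2 * t * (M / 2 * sqnorm v)).
have dp (t : R) : is_derive t 1 psi (dpsi t).
  have ? := is_derive_line (df (x + t *: v)).
  apply: is_deriveB; apply: is_derive_eq.
  by rewrite /= /GRing.scale /=; ring.
have [c c01] : exists2 c : R, c \in `]0, 1[%R & psi 1 - psi 0 = dpsi c * (1 - 0).
  apply: MVT => //; apply: derivable_within_continuous => t _.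
  exact: ex_derive.
move: c01; rewrite in_itv /= => /andP[c0 c1].
have : dpsi c <= 0.
  have : dot (gradient f (x + c *: v) - gradient f x) v <= M * c * sqnorm v.
    have E : x + c *: v - x = c *: v by rewrite addrAC subrr add0r.
    have := @lipschitz_gradient_sqnorm _ _ _ _ (x + c *: v) x M0 Lf.
    rewrite E => /(dot_lipschitz_le M0).
    rewrite !sqnormE !dotE => H.
    rewrite -(ler_pM2l c0); nra.
  by rewrite !dotE /dpsi; lra.
rewrite /psi scale1r scale0r addr0 => ?; lra.
Qed.

(** Convexity of [f - sqnorm / 2] at the point [x + t *: v], divided by [t], bounds a difference
    quotient of [f]; letting [t] decrease to 0 turns that quotient into the directional
    derivative. *)
Lemma strongly_convex_gradient (R : realType) (d : nat) (f : 'rV[R]_d.+1 -> R)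
    (x v : 'rV[R]_d.+1) :
  strongly_convex 1 f -> differentiable (f : 'rV[R]_d.+1 -> R^o) x ->
  f x + dot (gradient f x) v + 1 / 2 * sqnorm v <= f (x + v).
Proof.
move=> cf df.
have key (t : R) : 0 < t -> t < 1 ->
    t^-1 * (f (x + t *: v) - f x) <= f (x + v) - f x - 1 / 2 * (1 - t) * sqnorm v.
  move=> t0 t1.
  pose s : {i01 R} := Itv01 (ltW t0) (ltW t1).
  have := cf s (x + v) x; rewrite !inE => /(_ I I).
  rewrite convRE /conv /= /unstable.onem.
  have -> : t *: (x + v) + (1 - t) *: x = x + t *: v.
    by rewrite scalerDr scalerBl scale1r addrC addrA subrK.
  rewrite !sqnormE !dotE (dotC v x) => H.
  rewrite -(ler_pM2l t0) mulrA divff ?gt_eqF//; lra.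
pose g := fun h : R => h^-1 *: (((f : _ -> R^o) \o shift x) (h *: v) - (f x : R^o)).
have cg : g h @[h --> (0:R)^'+] --> dot (gradient f x) v.
  apply: cvg_dnbhs_at_right.
  by have := @diff_derivable _ _ _ _ _ v df; rewrite -derive_gradient.
have cb : (f (x + v) - f x - 1 / 2 * (1 - h) * sqnorm v) @[h --> (0:R)^'+] -->
    f (x + v) - f x - 1 / 2 * (1 - 0) * sqnorm v.
  apply: cvg_at_right_filter.
  apply: cvgB; first exact: cvg_cst.
  apply: cvgM; last exact: cvg_cst.
  apply: cvgM; first exact: cvg_cst.
  by apply: cvgB; [exact: cvg_cst|exact: cvg_id].
suff : dot (gradient f x) v <= f (x + v) - f x - 1 / 2 * (1 - 0) * sqnorm v.
  by move=> ?; lra.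
apply: ler_cvg_to cg cb _.
near=> h; rewrite /g /= [_ *: _]/GRing.scale /= [h *: v + x]addrC.
by apply: key; near: h; [exact: nbhs_right_gt|exact: nbhs_right_lt].
Unshelve. all: by end_near.
Qed.

(** This is cocoercivity of the gradient of [f - sqnorm / 2], a convex function with smoothness
    constant [M - 1], rewritten in terms of [f]. *)
Lemma interpolation (R : realType) (d : nat) (M : R) (f : 'rV[R]_d.+1 -> R)
    (x y : 'rV[R]_d.+1) : 1 < M -> smooth_strongly_convex 1 M f ->
  f y + dot (gradient f y) (x - y) + 1 / 2 * sqnorm (x - y)
    + (2 * (M - 1))^-1
      * sqnorm ((gradient f x - gradient f y) - (x - y)) <= f x.
Proof.
move=> M1 [_ cf Lf]; have M0 : 0 <= M by lra.
set e := (gradient f x - gradient f y) - (x - y).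
(* Compare the lower bound at y and the upper bound at x at the minimizer of
   their difference, x - e / (M - 1). *)
have := @strongly_convex_gradient _ _ f y (x - y - (M - 1)^-1 *: e) cf (Lf.1 y).
have := @descent _ _ M f x (- (M - 1)^-1 *: e) M0 Lf.
have -> : y + (x - y - (M - 1)^-1 *: e) = x + - (M - 1)^-1 *: e.
  by rewrite !addrA [y + x]addrC addrK scaleNr.
have -> : gradient f x = e + (x - y) + gradient f y by rewrite /e !subrK.
move: (gradient f y) e (f (x + _)) => g e fz; have L0 : 0 < M - 1 by lra.
rewrite !sqnormE !dotE (dotC e x) (dotC e y) (dotC y x).
set k := (M - 1)^-1; have -> : M = k^-1 + 1 by rewrite /k invrK subrK.
have k0 : 0 < k by rewrite invr_gt0.
have -> : (2 * (k^-1 + 1 - 1))^-1 = k / 2 by rewrite addrK invfM invrK mulrC.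
have -> : (k^-1 + 1) / 2 * (- k * (- k * dot e e)) = (k + k ^+ 2) / 2 * dot e e.
  by field; rewrite gt_eqF.
lra.
Qed.

(** * The noiseless two-step rate *)

Lemma dot0l (R : realType) (d : nat) (x : 'rV[R]_d.+1) : dot 0 x = 0.
Proof. by rewrite -(scale0r x) dotZl mul0r. Qed.

Lemma dot0r (R : realType) (d : nat) (x : 'rV[R]_d.+1) : dot x 0 = 0.
Proof. by rewrite dotC dot0l. Qed.

Lemma silver_two_step (R : realType) (d : nat) (k : R) (f : 'rV[R]_d.+1 -> R)
    (xs x0 : 'rV[R]_d.+1) : 0 < k -> 0 < 2 - k ^+ 2 ->
  smooth_strongly_convex 1 (2 * (1 + k) / (2 - k ^+ 2)) f ->
  gradient f xs = 0 ->
  let x1 := x0 - ((2 - k ^+ 2) / (2 + k)) *: gradient f x0 in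
  sqnorm (x1 - ((2 - k ^+ 2) / ((2 - k) * (1 + k))) *: gradient f x1 - xs)
    <= (k ^+ 2 / ((2 - k) * (2 + k))) ^+ 2 * sqnorm (x0 - xs).
Proof.
move=> k0 k2; set M := 2 * _ / _; set a := (_ / (2 + k)); set b := (_ / (_ * _)).
move=> Sf gs /=; set x1 := x0 - _ *: _.
have k2' : k < 2 by nra.
have ML : M - 1 = k * (k + 2) / (2 - k ^+ 2) by rewrite /M; field; rewrite gt_eqF.
have M1 : 1 < M.
  by rewrite -subr_gt0 ML divr_gt0// mulr_gt0// addr_gt0.
have Q01 := @interpolation _ _ _ _ x0 x1 M1 Sf.
have Q10 := @interpolation _ _ _ _ x1 x0 M1 Sf.
have Qs0 := @interpolation _ _ _ _ xs x0 M1 Sf.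
have Q1s := @interpolation _ _ _ _ x1 xs M1 Sf.
have Qs1 := @interpolation _ _ _ _ xs x1 M1 Sf.
move: Q01 Q10 Qs0 Q1s Qs1; rewrite gs.
set X := x0 - xs.
have -> : xs - x0 = - X by rewrite opprB.
have -> : x0 - x1 = a *: gradient f x0 by rewrite /x1 subKr.
have -> : x1 - x0 = - (a *: gradient f x0) by rewrite /x1 addrC addKr.
have E : x1 - xs = X - a *: gradient f x0 by rewrite /x1 addrAC.
have -> : xs - x1 = a *: gradient f x0 - X by rewrite -opprB E opprB.
rewrite [x1 - _ - xs]addrAC E.
clear E Sf gs.
move: (gradient f x0) (gradient f x1) (f x0) (f x1) (f xs) X => p q f0 f1 fs X.
rewrite invfM ML invf_div !sqnormE !(dotE, dot0l, dot0r).
rewrite (dotC p X) (dotC q X) (dotC q p).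
(* The data are now linear in three function values and six inner products, which may be treated as
   free real variables. *)
move: (dot X X) (dot X p) (dot X q) (dot p p) (dot p q) (dot q q).
move=> XX Xp Xq pp pq qq.
move=> Q01 Q10 Qs0 Q1s Qs1.
(* [D01], [D10], [Ds0], [D1s], [Ds1] are the slacks of the five interpolation inequalities and [gap]
   is that of the claim, so the certificate becomes an identity that [field] checks. *)
move: Q01; rewrite -subr_ge0; set D01 := (X in 0 <= X) => Q01.
move: Q10; rewrite -subr_ge0; set D10 := (X in 0 <= X) => Q10.
move: Qs0; rewrite -subr_ge0; set Ds0 := (X in 0 <= X) => Qs0.
move: Q1s; rewrite -subr_ge0; set D1s := (X in 0 <= X) => Q1s.
move: Qs1; rewrite -subr_ge0; set Ds1 := (X in 0 <= X) => Qs1.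
rewrite -subr_ge0.
(* The certificate must vanish on both extreme quadratics; this leaves a one-parameter
   family of multipliers, cut down here to give (x0, xs) multiplier zero. *)
set gap := (X in 0 <= X).
have -> : gap = k * (2 - k ^+ 2) / ((2 - k) ^+ 2 * (1 + k) ^+ 2 * (k + 2))
    * (k ^+ 2 * (1 + k) * D01 + k ^+ 2 * D10 + k ^+ 3 * Ds0
       + 4 * (1 + k) * D1s + (4 + 4 * k - k ^+ 3) * Ds1).
  rewrite /gap /D01 /D10 /Ds0 /D1s /Ds1 /a /b; field.
  by rewrite !gt_eqF//; nra.
(* Since [k ^ 2 < 2], [k ^ 3 < 2 * k]; this is the only multiplier whose sign is not immediate. *)
have k3 : 0 <= 4 + 4 * k - k ^+ 3 by nra.
have k1 : 0 <= 1 + k by lra.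
by rewrite mulr_ge0// ?addr_ge0// ?mulr_ge0// ?exprn_ge0 ?invr_ge0 ?mulr_ge0
  ?exprn_ge0 ?ltW//; lra.
Qed.

(** * Averaging over the noise *)

Lemma dot_sumr (R : realType) (d n : nat) (x : 'rV[R]_d.+1)
    (F : 'I_n -> 'rV[R]_d.+1) :
  dot x (\sum_(i < n) F i) = \sum_(i < n) dot x (F i).
Proof. exact: (big_morph (dot x) (fun u v => dotDr u v x) (dot0r x)). Qed.

Lemma natr_avgr_const (R : realType) (n : nat) (c : R) : (0 < n)%N ->
  n%:R^-1 * (\sum_(i < n) c) = c.
Proof.
move=> n0; rewrite sumr_const card_ord -[c *+ n]mulr_natl mulKf//.
by rewrite pnatr_eq0 -lt0n.
Qed.

Lemma avg_deviation_eq0 (R : realType) (d n : nat) (gr : 'rV[R]_d.+1)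
    (G : 'I_n -> 'rV[R]_d.+1) : (0 < n)%N ->
  n%:R^-1 *: (\sum_(i < n) G i) = gr -> \sum_(i < n) (G i - gr) = 0.
Proof.
move=> n0 <-; rewrite sumrB sumr_const card_ord -scaler_nat scalerA divff.
  by rewrite scale1r subrr.
by rewrite pnatr_eq0 -lt0n.
Qed.

(** Expanding around the mean gradient, the cross terms cancel because the deviations sum to zero,
    and the variance condition bounds the rest. *)
Lemma avg_sqnorm_step (R : realType) (d n : nat) (sigma beta : R)
    (gr z : 'rV[R]_d.+1) (G : 'I_n -> 'rV[R]_d.+1) : (0 < n)%N ->
  stochastic_gradient_at sigma gr G ->
  n%:R^-1 * (\sum_(i < n) sqnorm (z - beta *: G i))
    <= sqnorm (z - beta *: gr) + beta ^+ 2 * sigma ^+ 2.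
Proof.
move=> n0 [mean var].
have E i : sqnorm (z - beta *: G i) = sqnorm (z - beta *: gr)
    - 2 * beta * dot (z - beta *: gr) (G i - gr)
    + beta ^+ 2 * sqnorm (G i - gr).
  have -> : z - beta *: G i = (z - beta *: gr) - beta *: (G i - gr).
    by rewrite scalerBr opprB addrA subrK.
  move: (z - _) (G i - _) => u w.
  by rewrite !sqnormE !dotE (dotC w u); ring.
have D : \sum_(i < n) dot (z - beta *: gr) (G i - gr) = 0.
  by rewrite -dot_sumr (avg_deviation_eq0 n0 mean) dot0r.
rewrite (eq_bigr _ (fun i _ => E i)) big_split /= sumrB.
rewrite -!mulr_sumr D mulr0 subr0 mulrDr natr_avgr_const// lerD2l.
by rewrite mulrCA ler_wpM2l// sqr_ge0.
Qed.

(** Young's inequality: the difference of the two sides is [e^-1 * sqnorm (e *: w - (u - w))]. *)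
Lemma sqnorm_young (R : realType) (d : nat) (e : R) (u w : 'rV[R]_d.+1) :
  0 < e -> sqnorm u <= (1 + e) * sqnorm w + (1 + e^-1) * sqnorm (u - w).
Proof.
move=> e0.
have := sqnorm_ge0 (e *: w - (u - w)).
have [w' ->] : exists w', u = w + w' by exists (u - w); rewrite addrC subrK.
rewrite addrAC subrr add0r !sqnormE !dotE (dotC w' w) => H.
rewrite -subr_ge0.
suff -> : (1 + e) * dot w w + (1 + e^-1) * dot w' w' -
    (dot w w + dot w w' + (dot w w' + dot w' w')) =
  e^-1 * (e * (e * dot w w - dot w w') - (e * dot w w' - dot w' w')).
  by rewrite mulr_ge0 ?invr_ge0 ?(ltW e0).
by field; rewrite gt_eqF.
Qed.

(** A crude constant is enough: the bound enters only the coefficient of [sigma ^ 2] and the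
    finiteness of the optimal value. *)
Lemma gradient_step_lipschitz (R : realType) (d : nat) (M beta : R)
    (f : 'rV[R]_d.+1 -> R) (x y : 'rV[R]_d.+1) : 0 <= M ->
  lipschitz_gradient M f ->
  sqnorm ((x - beta *: gradient f x) - (y - beta *: gradient f y))
    <= 2 * (1 + beta ^+ 2 * M ^+ 2) * sqnorm (x - y).
Proof.
move=> M0 Lf; have := @lipschitz_gradient_sqnorm _ _ _ _ x y M0 Lf.
have -> : (x - beta *: gradient f x) - (y - beta *: gradient f y)
    = (x - y) - beta *: (gradient f x - gradient f y).
  by rewrite scalerBr !opprB addrACA [RHS]addrACA; congr (_ + _); rewrite addrC.
move: (x - y) (_ - _) => u w H.
have := sqnorm_ge0 (u + beta *: w).
have : beta ^+ 2 * sqnorm w <= beta ^+ 2 * (M ^+ 2 * sqnorm u).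
  by rewrite ler_wpM2l// sqr_ge0.
rewrite !sqnormE !dotE (dotC w u); lra.
Qed.

(** Each noisy run is compared with the noiseless one. The second step's noise contributes
    [beta ^ 2 * sigma ^ 2]; Young's inequality with weight [e] separates the first step's noise, of
    size [alpha] times the gradient error, after its amplification by the second gradient step. *)
Lemma pep_objective_le (R : realType) (d n : nat)
    (M r sigma alpha beta e : R) (Xi : Type) (f : 'rV[R]_d.+1 -> R)
    (xs x0 : 'rV[R]_d.+1) (g : 'rV[R]_d.+1 -> Xi -> 'rV[R]_d.+1)
    (xi0 : 'I_n -> Xi) (xi1 : 'I_n -> 'I_n -> Xi) :
  0 <= M -> (0 < n)%N -> 0 < e ->
  pep_feasible M r sigma alpha f xs x0 g xi0 xi1 ->
  let x1 := x0 - alpha *: gradient f x0 in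
  pep_objective alpha beta xs x0 g xi0 xi1
    <= (1 + e) * sqnorm (x1 - beta *: gradient f x1 - xs)
     + ((1 + e^-1) * (2 * (1 + beta ^+ 2 * M ^+ 2)) * alpha ^+ 2 + beta ^+ 2)
       * sigma ^+ 2.
Proof.
move=> M0 n0 e0 [[_ _ Lf] _ _ sg0 sg1] /=.
set x1 := x0 - alpha *: gradient f x0; set L := 2 * _.
have L0 : 0 <= L by rewrite mulr_ge0// addr_ge0// mulr_ge0// sqr_ge0.
have ni : 0 <= n%:R^-1 :> R by rewrite invr_ge0 ler0n.
pose y i := first_iterate alpha x0 g xi0 i.
set A := sqnorm _.
have step i : n%:R^-1 * (\sum_(j < n) sqnorm (y i - beta *: g (y i) (xi1 i j) - xs))
   <= (1 + e) * A
      + (1 + e^-1) * L * alpha ^+ 2 * sqnorm (g x0 (xi0 i) - gradient f x0)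
      + beta ^+ 2 * sigma ^+ 2.
  have := @avg_sqnorm_step _ _ _ _ beta _ (y i - xs) _ n0 (sg1 i).
  under eq_bigr do rewrite addrAC.
  move=> /le_trans; apply; rewrite lerD2r.
  have := sqnorm_young (y i - xs - beta *: gradient f (y i))
    (x1 - beta *: gradient f x1 - xs) e0.
  move=> /le_trans; apply; rewrite lerD2l -!mulrA ler_wpM2l//.
    by rewrite addr_ge0// invr_ge0 ltW.
  have := @gradient_step_lipschitz _ _ M beta f (y i) x1 M0 Lf.
  have -> : y i - xs - beta *: gradient f (y i) - (x1 - beta *: gradient f x1 - xs)
    = y i - beta *: gradient f (y i) - (x1 - beta *: gradient f x1).
    by rewrite [y i - xs - _]addrAC opprB addrA subrK.
  have -> : y i - x1 = - alpha *: (g x0 (xi0 i) - gradient f x0).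
    by rewrite /y /first_iterate /x1 scaleNr scalerBr !opprB addrC subrKA.
  rewrite [in X in _ <= X -> _]sqnormE dotZr dotZl -sqnormE => /le_trans; apply.
  by rewrite /L; lra.
(* The factor [1 / n ^ 2] is split into two nested averages, and [step] bounds the inner one. *)
rewrite /pep_objective -exprVn expr2 -mulrA mulr_sumr.
apply: (le_trans (ler_wpM2l ni (ler_sum _ (fun i _ => step i)))).
rewrite big_split /= big_split /= !mulrDr !natr_avgr_const// -mulr_sumr mulrCA.
rewrite -addrA lerD2l [in leRHS]mulrDl lerD2r ler_wpM2l//; last exact: sg0.2.
by rewrite mulr_ge0 ?sqr_ge0// mulr_ge0// addr_ge0// invr_ge0 ltW.
Qed.

(** * The one-dimensional quadratic and the lower bound *)

Lemma sqnorm1 (R : realType) (x : 'rV[R]_1) : sqnorm x = x 0 0 ^+ 2.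
Proof. by rewrite /sqnorm big_ord1. Qed.

Lemma differentiable_half_sqnorm (R : realType) (x : 'rV[R]_1) :
  differentiable ((fun y => 1 / 2 * sqnorm y) : 'rV[R]_1 -> R^o) x.
Proof.
have -> : ((fun y => 1 / 2 * sqnorm y) : 'rV[R]_1 -> R^o)
    = (fun y : 'rV[R]_1 => ((1 / 2 : R) *: (y 0 0 * y 0 0 : R^o) : R^o)).
  by apply/funext => y; rewrite sqnorm1 expr2.
apply: differentiableZ; apply: differentiableM; exact: differentiable_coord.
Qed.

Lemma gradient_half_sqnorm (R : realType) (x : 'rV[R]_1) :
  gradient (fun y => 1 / 2 * sqnorm y) x = x.
Proof.
set f := fun y => _; apply/rowP => j; rewrite ord1.
pose v : 'rV[R]_1 := const_mx 1.
have := @is_derive_line R 0 f x v 0 (differentiable_half_sqnorm _).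
rewrite scale0r addr0 /dot big_ord1 [v 0 0]mxE mulr1.
have -> : (fun s : R => f (x + s *: v) : R^o)
    = (fun s : R => (1 / 2 * (x 0 0 + s) ^+ 2 : R^o)).
  by apply/funext => s; rewrite /f sqnorm1 !mxE mulr1.
move=> /@derive_val <-.
have /@derive_val -> : is_derive (0 : R) 1
    (fun s : R => (1 / 2 * (x 0 0 + s) ^+ 2 : R^o)) (x 0 0) => //.
apply: is_derive_eq.
rewrite /GRing.scale /=.
by field.
Qed.

Lemma half_sqnorm_smooth_strongly_convex (R : realType) (M : R) : 1 <= M ->
  smooth_strongly_convex 1 M (fun y : 'rV[R]_1 => 1 / 2 * sqnorm y).
Proof.
move=> M1; split.
- rewrite /closed_function.
  have -> : [set p : ('rV[R]_1 * R)%type | 1 / 2 * sqnorm p.1 <= p.2]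
      = (fun p : ('rV[R]_1 * R)%type => 1 / 2 * sqnorm p.1 - p.2)
        @^-1` [set y | y <= 0].
    by apply/seteqP; split => p /=; rewrite subr_le0.
  apply: preimage_closed; last exact: closed_le.
  move=> p _; apply: cvgB; last exact: cvg_snd.
  apply: (@continuous_comp _ _ _ fst (fun y => 1 / 2 * sqnorm y)).
    exact: cvg_fst.
  exact/differentiable_continuous/differentiable_half_sqnorm.
- by move=> t x y _ _; rewrite convRE !subrr !mulr0 addr0.
- split=> [x|x y]; first exact: differentiable_half_sqnorm.
  by rewrite !gradient_half_sqnorm ler_peMl// sqrtr_ge0.
Qed.

Lemma pep_value_ge (R : realType) (M : R) (n : nat) (alpha beta r sigma : R) :
  1 <= M -> (0 < n)%N -> 
  ((((1 - alpha) * (1 - beta)) ^+ 2 * r ^+ 2)%:E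
    <= pep_value M n alpha beta r sigma)%E.
Proof.
move=> M1 n0; apply: ereal_sup_ubound.
(* The index 0 encodes dimension one. Starting from [r], with minimizer 0 and exact gradients, each
   step multiplies the iterate by one minus the stepsize. *)
exists 0%N, unit, (fun y => 1 / 2 * sqnorm y), 0, (const_mx r),
  (fun x _ => x), (fun _ => tt), (fun _ _ => tt).
have sg (x : 'rV[R]_1) : @stochastic_gradient_at R 0 n sigma x (fun _ => x).
  split; rewrite ?subrr ?sqnorm0.
    rewrite sumr_const card_ord -[x *+ n]scaler_nat scalerA mulVf ?scale1r//.
    by rewrite pnatr_eq0 -lt0n.
  by rewrite natr_avgr_const// sqr_ge0.
split.
  split; rewrite ?gradient_half_sqnorm//.
  - exact: half_sqnorm_smooth_strongly_convex.
  - by rewrite subr0 sqnorm1 mxE.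
  - by move=> i /=; rewrite gradient_half_sqnorm.
congr (_%:E); rewrite /pep_objective /first_iterate /=.
under eq_bigr => i _ do under eq_bigr => j _ do rewrite subr0 sqnorm1 !mxE.
rewrite !sumr_const !card_ord -mulrnA -[_ *+ (n * n)]mulr_natl natrM -expr2 mulKf.
  by ring.
by rewrite expf_neq0// pnatr_eq0 -lt0n.
Qed.

(** * Upper bounds on the optimal value *)

(** The minimizer is fixed by every gradient step, so a step of size [a] enlarges the squared
    distance to it by a factor at most [L a]; the noise bound with [e = 1] does the rest. *)
Lemma pep_value_lt_pinfty (R : realType) (M : R) (n : nat)
    (alpha beta r sigma : R) : 0 <= M -> (0 < n)%N ->
  (pep_value M n alpha beta r sigma < +oo)%E.
Proof.
move=> M0 n0.
set L := fun a : R => 2 * (1 + a ^+ 2 * M ^+ 2).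
have L0 a : 0 <= L a by rewrite mulr_ge0// addr_ge0// mulr_ge0// sqr_ge0.
apply: (@le_lt_trans _ _ ((1 + 1) * (L beta * (L alpha * r ^+ 2)) +
  ((1 + 1^-1) * L beta * alpha ^+ 2 + beta ^+ 2) * sigma ^+ 2)%:E); last exact: ltry.
apply: ge_ereal_sup => _ [d [Xi [f [xs [x0 [g [xi0 [xi1 [feas ->]]]]]]]]].
rewrite lee_fin; apply: le_trans (pep_objective_le _ M0 n0 ltr01 feas) _.
have [[_ _ Lf] gs x0r _ _] := feas.
rewrite lerD2r ler_wpM2l//.
have step a z : sqnorm (z - a *: gradient f z - xs) <= L a * sqnorm (z - xs).
  have := @gradient_step_lipschitz _ _ M a f z xs M0 Lf.
  by rewrite gs scaler0 subr0.
apply: le_trans (step _ _) _; rewrite ler_wpM2l//.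
by apply: le_trans (step _ _) _; rewrite ler_wpM2l.
Qed.

Lemma silver_value_le (R : realType) (k r sigma e : R) (n : nat) :
  0 < k -> 0 < 2 - k ^+ 2 -> (0 < n)%N -> 0 < e ->
  let M := 2 * (1 + k) / (2 - k ^+ 2) in
  let alpha := (2 - k ^+ 2) / (2 + k) in
  let beta := (2 - k ^+ 2) / ((2 - k) * (1 + k)) in
  (pep_value M n alpha beta r sigma <=
   ((1 + e) * (k ^+ 2 / ((2 - k) * (2 + k))) ^+ 2 * r ^+ 2
     + ((1 + e^-1) * (2 * (1 + beta ^+ 2 * M ^+ 2)) * alpha ^+ 2 + beta ^+ 2)
       * sigma ^+ 2)%:E)%E.
Proof.
move=> k0 k2 n0 e0 /=; set M := 2 * (1 + k) / _.
have M0 : 0 <= M by rewrite divr_ge0 ?(ltW k2)// mulr_ge0// addr_ge0// ltW.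
apply: ge_ereal_sup => _ [d [Xi [f [xs [x0 [g [xi0 [xi1 [feas ->]]]]]]]]].
rewrite lee_fin; apply: le_trans (pep_objective_le _ M0 n0 e0 feas) _.
have [Sf gs x0r _ _] := feas.
rewrite lerD2r -mulrA ler_wpM2l ?addr_ge0 ?(ltW e0)//.
have /= H := @silver_two_step _ _ _ _ _ x0 k0 k2 Sf gs.
apply: le_trans H _.
by rewrite ler_wpM2l// sqr_ge0.
Qed.

(** * The schedule at [v = 0] *)

(** At [v = 0] the cubic has the roots 1, the stated value and a negative number; the prescribed
    interval excludes the first and the last. *)
Lemma alpha_star0 (R : realType) (k : R) (n : nat) : 0 < k ->
  0 < 2 - k ^+ 2 -> (0 < n)%N ->
  alpha_star (2 * (1 + k) / (2 - k ^+ 2)) n 0 = (2 - k ^+ 2) / (2 + k).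
Proof.
move=> k0 k2 n0; rewrite /alpha_star; set M := 2 * _ / _.
have nR : (n%:R : R) != 0 by rewrite pnatr_eq0 -lt0n.
have k2p : 0 < 2 + k by lra.
have M1 : 1 < M by rewrite /M ltr_pdivlMr//; nra.
have cubicE (y : R) : (M - 1) * M * n%:R * y ^+ 3 - (M + 1) * (M - 2) * n%:R * y ^+ 2
      - (4 * n%:R + (M - 1) * (n%:R - 1) * 0) * y + 2 * n%:R
    = n%:R * (y - 1) * (y - (2 - k ^+ 2) / (2 + k))
      * (M * (M - 1) * (y + (2 - k ^+ 2) / (2 + k)) + 2).
  by rewrite /M; field; rewrite !gt_eqF.
apply: xget_unique.
  split; last by rewrite cubicE subrr mulr0 mul0r.
  apply/andP; split; last by rewrite ltr_pdivrMr//; nra.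
  rewrite /M invf_div ler_pdivrMr ?mulr_gt0//; last lra.
  by rewrite mulrAC ler_pdivlMr// ler_pM2l//; lra.
move=> y [/andP[My y1]]; rewrite cubicE => /esym/eqP.
have y0 : 0 < y by apply: lt_le_trans My; rewrite invr_gt0; lra.
have a0 : 0 < (2 - k ^+ 2) / (2 + k) by rewrite divr_gt0.
rewrite mulf_eq0 mulf_eq0 mulf_eq0 (negbTE nR) /= subr_eq0 (lt_eqF y1) /= subr_eq0.
case/orP => [/eqP//|]; rewrite gt_eqF//.
by rewrite addr_gt0// mulr_gt0// ?addr_gt0// mulr_gt0//; lra.
Qed.

(** At [v = 0] the quadratic splits over the rationals in [k]; its second root is negative, hence
    below the prescribed interval. *)
Lemma beta_star0 (R : realType) (k : R) (n : nat) : 0 < k ->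
  0 < 2 - k ^+ 2 -> (0 < n)%N ->
  beta_star (2 * (1 + k) / (2 - k ^+ 2)) n 0
    = (2 - k ^+ 2) / ((2 - k) * (1 + k)).
Proof.
move=> k0 k2 n0; rewrite /beta_star alpha_star0//; set M := 2 * _ / _.
set a := _ / (2 + k).
have nR : (n%:R : R) != 0 by rewrite pnatr_eq0 -lt0n.
have k2p : 0 < 2 + k by lra.
have k2m : 0 < 2 - k by nra.
have k1p : 0 < 1 + k by lra.
have M1 : 1 < M by rewrite /M ltr_pdivlMr//; nra.
have a0 : 0 < a by rewrite divr_gt0.
have quadE (b : R) :
  M * n%:R * ((M - 1) ^+ 2 * n%:R + (M + 1) ^+ 2 * (n%:R - 1) * 0)
        * ((M - 1) * a + (M + 1)) * b ^+ 2
      + 2 * M *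
        (2 * (M - 1) * M * n%:R * (- n%:R + (n%:R - 1) * 0) * a ^+ 2
         + (1 + M) * (- n%:R + (n%:R - 1) * 0)
           * ((3 - M) * n%:R + (M - 1) * (n%:R - 1) * 0) * a
         + n%:R * (n%:R - (M - 4) * M * n%:R - (1 + M) * (3 + M) * (n%:R - 1) * 0))
        * b
      + (- 2 * M * (M ^+ 2 - 1) * n%:R * (- n%:R + (n%:R - 1) * 0) * a ^+ 2
         + (2 * (2 + M + 2 * M ^+ 2 - M ^+ 3) * n%:R ^+ 2
            + (M - 3) * (1 + M) ^+ 2 * (n%:R - 1) * n%:R * 0
            + (1 - M) * (1 + M) ^+ 2 * (n%:R - 1) ^+ 2 * 0 ^+ 2) * a
         + 2 * (1 + M) ^+ 2 * n%:R * (- n%:R + (n%:R - 1) * 0))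
  = n%:R ^+ 2 * M * (M - 1) ^+ 2 * ((M - 1) * a + (M + 1))
    * (b - (2 - k ^+ 2) / ((2 - k) * (1 + k)))
    * (b + (2 - k ^+ 2) / (k * (1 + k))).
  by rewrite /a /M; field; rewrite !gt_eqF.
apply: xget_unique.
  split; last by rewrite quadE subrr mulr0 mul0r.
  apply/andP; split.
    rewrite -subr_gt0.
    have -> : (2 - k ^+ 2) / ((2 - k) * (1 + k)) - a / M = (2 - k ^+ 2) * k
        * (4 + 2 * k - k ^+ 2) / (2 * (1 + k) * (2 - k) * (2 + k)).
      by rewrite /a /M; field; rewrite !gt_eqF.
    by apply: divr_gt0; repeat apply: mulr_gt0; lra.
  rewrite -subr_gt0.
  have -> : (M + 1) / (2 * M) - (2 - k ^+ 2) / ((2 - k) * (1 + k))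
      = k ^+ 3 / (4 * (1 + k) * (2 - k)).
    by rewrite /M; field; rewrite !gt_eqF.
  by rewrite divr_gt0 ?exprn_gt0 ?mulr_gt0.
move=> y [/andP[My y1]]; rewrite quadE => /esym/eqP.
have y0 : 0 < y by apply: lt_trans My; rewrite divr_gt0//; lra.
rewrite mulf_eq0 [X in X || _]mulf_eq0 subr_eq0 => /orP[/orP[|/eqP//]|].
  have Ma0 : 0 < (M - 1) * a by rewrite mulr_gt0// subr_gt0.
  have n2 : 0 < n%:R ^+ 2 :> R by rewrite exprn_gt0 ?ltr0n.
  have m2 : 0 < (M - 1) ^+ 2 by rewrite exprn_gt0 ?subr_gt0.
  have M0 : 0 < M by lra.
  have Ms : 0 < (M - 1) * a + (M + 1) by lra.
  by rewrite gt_eqF// mulr_gt0// mulr_gt0// mulr_gt0.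
by rewrite gt_eqF// addr_gt0// divr_gt0// mulr_gt0.
Qed.

(** * The parameter [k] and the comparison of rates *)

Lemma silver_parameter (R : realType) (M : R)
    (s := Num.sqrt (2 * M ^+ 2 - 2 * M + 1)) :
  1 < M -> exists k : R, [/\ 0 < k, 0 < 2 - k ^+ 2,
    M = 2 * (1 + k) / (2 - k ^+ 2) & s = 1 + k * M].
Proof.
move=> M1; exists ((s - 1) / M).
have M0 : 0 < M by lra.
have s2 : s ^+ 2 = 2 * M ^+ 2 - 2 * M + 1 by rewrite sqr_sqrtr//; nra.
have s1 : 1 < s by rewrite -(@ltr_pXn2r _ 2) ?nnegrE ?sqrtr_ge0// expr1n s2; nra.
have sE : s = 1 + (s - 1) / M * M by field; rewrite gt_eqF.
have k0 : 0 < (s - 1) / M by rewrite divr_gt0//; lra.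
move: ((s - 1) / M) k0 sE => k k0 sE.
(* Squaring [s = 1 + k * M] and cancelling a factor [M] gives this relation. *)
have E : M * (2 - k ^+ 2) = 2 * (1 + k).
  apply: (mulfI (lt0r_neq0 M0)); move: s2; rewrite sE; lra.
have k2 : 0 < 2 - k ^+ 2 by rewrite -(pmulr_rgt0 _ M0) E mulr_gt0// addr_gt0.
by split=> //; rewrite -E mulfK ?gt_eqF.
Qed.

(** Both sides are squares of nonnegative numbers, and the difference of the roots is an explicit
    fraction with positive factors. *)
Lemma silver_lt_constant (R : realType) (k : R) (M := 2 * (1 + k) / (2 - k ^+ 2)) :
  0 < k -> 0 < 2 - k ^+ 2 ->
  (k ^+ 2 / ((2 - k) * (2 + k))) ^+ 2 < ((M - 1) / (M + 1)) ^+ 4.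
Proof.
move=> k0 k2; have k2m : 0 < 2 - k by nra.
have -> : (M - 1) / (M + 1) = k * (2 + k) / (4 + 2 * k - k ^+ 2).
  rewrite /M; field.
  by rewrite !gt_eqF//; nra.
rewrite (exprM _ 2 2) ltr_pXn2r// ?nnegrE ?sqr_ge0//; last first.
  by rewrite divr_ge0 ?sqr_ge0// ltW// mulr_gt0// addr_gt0.
rewrite -subr_gt0.
have -> : (k * (2 + k) / (4 + 2 * k - k ^+ 2)) ^+ 2 - k ^+ 2 / ((2 - k) * (2 + k))
   = 2 * k ^+ 4 * (2 - k ^+ 2) / ((4 + 2 * k - k ^+ 2) ^+ 2 * (2 - k) * (2 + k)).
  field.
  by rewrite !gt_eqF//; nra.
by rewrite divr_gt0// ?mulr_gt0// ?exprn_gt0//; nra.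
Qed.

(** With [s = 1 + k * M], the quotient [(s - M) / (2 + s - M)] equals [k ^ 2 / (4 - k ^ 2)]. *)
Lemma ratio_boundE (R : realType) (k : R) (M := 2 * (1 + k) / (2 - k ^+ 2)) :
  0 < k -> 0 < 2 - k ^+ 2 ->
  Num.sqrt (2 * M ^+ 2 - 2 * M + 1) = 1 + k * M ->
  ratio_bound M = 1 / 2 + 1 / 2 *
    ((k ^+ 2 / ((2 - k) * (2 + k))) ^+ 2 / ((M - 1) / (M + 1)) ^+ 4).
Proof.
move=> k0 k2 sE; rewrite /ratio_bound /= sE; congr (_ + _ * _).
have k2m : 0 < 2 - k by nra.
rewrite /M; field.
by rewrite !gt_eqF//; nra.
Qed.

(** * The noise threshold and the final ratio *)

Lemma v_max_ge0 (R : realType) (M : R) (n : nat) : 1 < M -> (0 < n)%N ->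
  (0 <= v_max M n)%E.
Proof.
move=> M1 n0; rewrite /v_max; case: eqP => [|n1]; first by rewrite leey.
have n1' : 1 <= n%:R :> R by rewrite ler1n.
by rewrite lee_fin divr_ge0 ?mulr_ge0 ?ler0n//; lra.
Qed.

(* The conjunct 0 < h_constant < +oo makes the quotient of extended reals a
   genuine quotient of real numbers. *)
Theorem theorem3p4 (R : realType) (M : R) (n : nat)
    (hM : 1 < M) (hn : (0 < n)%N) :
  exists U : R, 0 < U /\
    forall r sigma : R, 0 < r -> 0 < sigma -> sigma / r < Num.sqrt U ->
      exists v : R,
        [/\ (0 <= v%:E <= v_max M n)%E,
            (0 < h_constant M n r sigma < +oo)%E,
            (h_silver M n v r sigma / h_constant M n r sigma
               <= (ratio_bound M)%:E)%E
          & ratio_bound M < 1].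
Proof.
have [k [k0 k2 ME sE]] := silver_parameter hM.
have k2m : 0 < 2 - k by nra.
have rc0 : 0 < ((M - 1) / (M + 1)) ^+ 4 by rewrite exprn_gt0// divr_gt0//; lra.
have rs0 : 0 < (k ^+ 2 / ((2 - k) * (2 + k))) ^+ 2.
  by rewrite exprn_gt0// divr_gt0 ?exprn_gt0// mulr_gt0// addr_gt0.
have lt_sc := silver_lt_constant k0 k2.
have value e := fun r sigma e0 => @silver_value_le R k r sigma e n k0 k2 hn e0.
have rbE : ratio_bound M = 1 / 2 + 1 / 2 *
    ((k ^+ 2 / ((2 - k) * (2 + k))) ^+ 2 / ((M - 1) / (M + 1)) ^+ 4).
  by move: sE; rewrite ME; exact: ratio_boundE.
rewrite -ME in lt_sc value.
have hsE r sigma : h_silver M n 0 r sigma = pep_value M n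
    ((2 - k ^+ 2) / (2 + k)) ((2 - k ^+ 2) / ((2 - k) * (1 + k))) r sigma.
  by rewrite /h_silver ME alpha_star0// beta_star0.
have hc_ge (r sigma : R) : 0 < r ->
    ((((M - 1) / (M + 1)) ^+ 4 * r ^+ 2)%:E <= h_constant M n r sigma)%E.
  move=> r0.
  have := @pep_value_ge R M n (2 / (M + 1)) (2 / (M + 1)) r sigma (ltW hM) hn.
  suff -> : 1 - 2 / (M + 1) = (M - 1) / (M + 1) by rewrite -expr2 -exprM.
  by field; rewrite gt_eqF//; lra.
have hc_lt r sigma : (h_constant M n r sigma < +oo)%E.
  by apply: pep_value_lt_pinfty => //; lra.
move: rbE lt_sc value rs0 rc0 hsE hc_ge.
set rs := (k ^+ 2 / _) ^+ 2; set rc := ((M - 1) / _) ^+ 4.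
set beta := _ / (_ * (1 + k)); set alpha := _ / (2 + k).
move=> rbE lt_sc value rs0 rc0 hsE hc_ge.
have b0 : 0 < beta by rewrite divr_gt0// mulr_gt0// addr_gt0.
pose q := rs / rc.
have q0 : 0 < q by rewrite divr_gt0.
have q1 : q < 1 by rewrite ltr_pdivrMr// mul1r.
have q1' : 0 < 1 - q by rewrite subr_gt0.
have rsE : rs = q * rc by rewrite /q divfK ?gt_eqF.
(* This makes [e * q = (1 - q) / 4]. The threshold below allows the noise another [(1 - q) / 4], and
   [q + (1 - q) / 2] is the target [(1 + q) / 2]. *)
pose e := (1 - q) / (4 * q).
have e0 : 0 < e by apply: divr_gt0; lra.
(* The coefficient of [sigma ^ 2] in the silver bound; like [k], [alpha], [beta] and [e], it is
   determined by [M]. *)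
pose C := (1 + e^-1) * (2 * (1 + beta ^+ 2 * M ^+ 2)) * alpha ^+ 2 + beta ^+ 2.
have C0 : 0 < C.
  rewrite ltr_wpDl ?exprn_gt0// mulr_ge0 ?sqr_ge0// mulr_ge0//.
    by rewrite addr_ge0// invr_ge0 ltW.
  by rewrite mulr_ge0// addr_ge0// mulr_ge0// sqr_ge0.
have U0 : 0 < rc * (1 - q) / (4 * C).
  by apply: divr_gt0; apply: mulr_gt0.
exists (rc * (1 - q) / (4 * C)); split=> //.
move=> r sigma r0 s0 small; exists 0; split.
- by rewrite lexx v_max_ge0.
- rewrite hc_lt andbT; apply: lt_le_trans (hc_ge _ _ r0).
  by rewrite lte_fin mulr_gt0// exprn_gt0.
- have noise : C * sigma ^+ 2 <= rc * (1 - q) / 4 * r ^+ 2.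
    have : (sigma / r) ^+ 2 < rc * (1 - q) / (4 * C).
      rewrite -[ltRHS]sqr_sqrtr ?(ltW U0)//.
      by rewrite ltr_pXn2r// nnegrE ?sqrtr_ge0// divr_ge0// ltW.
    rewrite expr_div_n ltr_pdivrMr ?exprn_gt0// => /ltW.
    rewrite -(ler_pM2l C0) => /le_trans; apply.
    by rewrite le_eqVlt; apply/orP; left; apply/eqP; field; rewrite gt_eqF.
  have hs_le : (h_silver M n 0 r sigma <= (ratio_bound M * (rc * r ^+ 2))%:E)%E.
    rewrite hsE; apply: le_trans (value e r sigma e0) _.
    rewrite lee_fin -/C rbE -/q rsE.
    have -> : (1 + e) * (q * rc) = q * rc + (1 - q) / 4 * rc.
      by rewrite /e; field; rewrite gt_eqF.
    lra.
  have hc := hc_ge r sigma r0.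
  have c0 : 0 < rc * r ^+ 2 by rewrite mulr_gt0// exprn_gt0.
  have rb0 : 0 <= ratio_bound M by rewrite rbE -/q; lra.
  (* The two bounds exclude both infinities, so the quotient is division by a positive real [c], at
     least [rc * r ^ 2]. *)
  move: hc (hc_lt r sigma); case: (h_constant M n r sigma) => [c| |]//.
  rewrite lee_fin => hc _; have c1 : 0 < c by apply: lt_le_trans hc.
  rewrite inver gt_eqF// lee_pdivrMr//; apply: le_trans hs_le _.
  by rewrite -EFinM lee_fin ler_wpM2l.
- by rewrite rbE -/q; lra.
Qed.
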